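(* Let $\phi=(H,\mathbf{M},\rho)$ be an SCNN with $L$ layers, feature numbers $F_0,\dots,F_L$, and Lipschitz continuous activation $\rho$. Let $(G_n)_n$ be a sequence of graphs with GSOs $(\mathbf{\Delta}_n)_n$ and GWMs $(\boldsymbol{A}_n)_n$, and let $W$ be a graphon with $G_n\xrightarrow[n\to\infty]{H}W$. Let $(\pi_n)_n$ be permutations ($\pi_n$ of $\{1,\dots,n\}$) with $\|T_{W_{\pi_n(\boldsymbol{A}_n)}}-T_W\|_{L^2[0,1]\to L^2[0,1]}\to0$, and let $\mathbf{x}_n\in\mathbb{R}^{n\times F_0}$ and $y\in(L^2[0,1])^{F_0}$ satisfy $\|\psi_{\pi_n(\mathbf{x}_n^k)}-y^k\|_{L^2[0,1]}\to0$ for every $k=1,\dots,F_0$. Then $$\|\psi_{\phi_{\pi_n(\mathbf{\Delta}_n)}(\pi_n(\mathbf{x}_n))}-\psi_{\phi_{\pi_m(\mathbf{\Delta}_m)}(\pi_m(\mathbf{x}_m))}\|_{L^2[0,1]^{F_L}}\xrightarrow{n,m\to\infty}0.$$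
   Context: An SCNN $\phi=(H,\mathbf{M},\rho)$: $L\in\mathbb{N}$, feature numbers $F_0,\dots,F_L$, continuous filters $h_l^{jk}:\mathbb{R}\to\mathbb{R}$, real weights $m_l^{jk}$, activation $\rho:\mathbb{R}\to\mathbb{R}$. Realization on a bounded self-adjoint operator $T$ (on real-valued signals): $x_0=x$, $x_l^j=\rho\big(\sum_{k}m_l^{jk}h_l^{jk}(T)x_{l-1}^k\big)$, output $x_L$, $\rho$ applied entrywise/pointwise, $h(T)$ continuous functional calculus; $\phi_{\mathbf{\Delta}}$ uses $T=\mathbf{\Delta}$ on $\mathbb{R}^n$. A graph with GSO $\mathbf{\Delta}\in\mathbb{R}^{n\times n}$ (symmetric) has GWM $\boldsymbol{A}=n\mathbf{\Delta}$. For a permutation $\pi$: $\pi(\boldsymbol{B})=(\boldsymbol{B}_{\pi(i)\pi(j)})_{ij}$, $\pi(\mathbf{x})=(x_{\pi(i)})_i$ (applied featurewise to feature maps). With $P_k=[(k-1)/n,k/n)$: $W_{\boldsymbol{B}}(u,v)=\sum_{i,j}\boldsymbol{B}_{ij}\chi_{P_i}(u)\chi_{P_j}(v)$, $\psi_{\mathbf{x}}=\sum_jx_j\chi_{P_j}$ (featurewise for feature maps). Graphon: bounded symmetric measurable $W:[0,1]^2\to\mathbb{R}$, $T_W\psi(v)=\int_0^1W(v,u)\psi(u)du$. Norm on $(L^2[0,1])^d$: $\max_k\|y^k\|_{L^2}$. Homomorphism densities: $t(F,G)=|\sum_{\psi:V(F)\to V(G)}\prod_{(u,v)\in E(F)}\boldsymbol{A}_{\psi(u)\psi(v)}|/n^{|V(F)|}$,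 $t(F,W)=\int\prod_{(i,j)\in E(F)}W(u_i,u_j)\prod du_i$. $G_n\xrightarrow{H}W$: $G_n$ has $n$ nodes, GWMs uniformly bounded (entrywise), and $t(F,G_n)\to t(F,W)$ for every simple graph $F$. *)

(* Defs.v *)
From HB Require Import structures.
From mathcomp Require Import all_boot all_order all_algebra all_fingroup.
From mathcomp Require Import all_classical all_reals all_analysis.
Set Implicit Arguments. Unset Strict Implicit. Unset Printing Implicit Defensive.
Import Order.TTheory GRing.Theory Num.Theory.
Import numFieldNormedType.Exports.
Local Open Scope classical_set_scope.
Local Open Scope ring_scope.

Section Defs.
Variable R : realType.
Local Notation mu := (@lebesgue_measure R).
Definition I01 : set R := `[0, 1].

(* Continuous functional calculus h(D) for a (symmetric) matrix D:
   p(D) for any polynomial p interpolating h on the spectrum of D. *)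
Definition is_eigval (n : nat) (D : 'M[R]_n) (a : R) : Prop :=
  exists v : 'cV[R]_n, v != 0 /\ D *m v = a *: v.
Definition poly_mx (n : nat) (p : {poly R}) (D : 'M[R]_n) : 'M[R]_n :=
  \sum_(i < size p) p`_i *: iter i (mulmx D) 1%:M.
Definition matfun (n : nat) (h : R -> R) (D : 'M[R]_n) : 'M[R]_n :=
  xget 0 [set B | exists p : {poly R},
     (forall a, is_eigval D a -> p.[a] = h a) /\ B = poly_mx p D].

Definition scnn_layer (F : nat -> nat) (h : nat -> nat -> nat -> R -> R)
  (m : nat -> nat -> nat -> R) (rho : R -> R) (n l : nat) (D : 'M[R]_n)
  (X : 'M[R]_(n, F l.-1)) : 'M[R]_(n, F l) :=
  \matrix_(i < n, j < F l)
     rho ((\sum_(k < F l.-1) m l j k *: (matfun (h l j k) D *m col k X)) i ord0).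

Fixpoint scnn_real (F : nat -> nat) (h : nat -> nat -> nat -> R -> R)
  (m : nat -> nat -> nat -> R) (rho : R -> R) (n : nat) (D : 'M[R]_n)
  (x : 'M[R]_(n, F 0)) (l : nat) : 'M[R]_(n, F l) :=
  match l return 'M[R]_(n, F l) with
  | 0 => x
  | l'.+1 => @scnn_layer F h m rho n l'.+1 D (@scnn_real F h m rho n D x l')
  end.

Definition perm_mat (n : nat) (s : 'S_n) (B : 'M[R]_n) : 'M[R]_n :=
  \matrix_(i, j) B (s i) (s j).
Definition perm_feat (n d : nat) (s : 'S_n) (X : 'M[R]_(n, d)) : 'M[R]_(n, d) :=
  \matrix_(i, k) X (s i) k.

(* indicator of P_{j+1} = [j/n, (j+1)/n) (0-indexed j) *)
Definition chiP (n j : nat) (u : R) : R :=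
  if (j%:R / n%:R <= u) && (u < j.+1%:R / n%:R) then 1 else 0.

Definition psi (n : nat) (x : 'I_n -> R) (u : R) : R :=
  \sum_(j < n) x j * chiP n j u.

Definition stepW (n : nat) (B : 'M[R]_n) (u v : R) : R :=
  \sum_(i < n) \sum_(j < n) B i j * chiP n i u * chiP n j v.

Definition L2norm (f : R -> R) : R :=
  Num.sqrt (fine (\int[mu]_(u in I01) ((f u) ^+ 2)%:E)%E).

Definition inL2 (f : R -> R) : Prop :=
  measurable_fun I01 f /\ (\int[mu]_(u in I01) ((f u) ^+ 2)%:E < +oo)%E.

Definition TW (W : R -> R -> R) (f : R -> R) (v : R) : R :=
  fine (\int[mu]_(u in I01) (W v u * f u)%:E)%E.

Definition opnorm_diff (W1 W2 : R -> R -> R) : \bar R :=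
  ereal_sup [set (L2norm (fun v => TW W1 f v - TW W2 f v))%:E
            | f in [set f | inL2 f /\ L2norm f <= 1]].

Definition is_graphon (W : R -> R -> R) : Prop :=
  [/\ measurable_fun (I01 `*` I01) (fun p : R * R => W p.1 p.2),
      exists C : R, forall u v, u \in I01 -> v \in I01 -> `|W u v| <= C
    & forall u v, u \in I01 -> v \in I01 -> W u v = W v u].

Fixpoint iint (k : nat) (f : (nat -> R) -> R) : R :=
  match k with
  | 0 => f (fun _ => 0)
  | k'.+1 => fine (\int[mu]_(u in I01)
        (iint k' (fun x => f (fun i => if i == k' then u else x i)))%:E)%E
  end.

(* simple graph F on vertex set 'I_k: each edge {i,j} listed once as (i,j), i<j *)
Definition simple_edges (k : nat) (E : {set 'I_k * 'I_k}) : Prop :=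
  forall e, e \in E -> (e.1 < e.2)%N.

Definition hom_graph (k : nat) (E : {set 'I_k * 'I_k}) (n : nat) (A : 'M[R]_n) : R :=
  `| \sum_(f : {ffun 'I_k -> 'I_n}) \prod_(e in E) A (f e.1) (f e.2) | / (n%:R ^+ k).

Definition hom_graphon (k : nat) (E : {set 'I_k * 'I_k}) (W : R -> R -> R) : R :=
  iint k (fun x => \prod_(e in E) W (x e.1) (x e.2)).

End Defs.

(* Main.v *)
Require Import Defs.
From HB Require Import structures.
From mathcomp Require Import all_boot all_order all_algebra all_fingroup.
From mathcomp Require Import all_classical all_reals all_analysis.
From mathcomp Require Import measurable_realfun ring lra polyrcf complex.
Import Order.TTheory GRing.Theory Num.Theory.
Import numFieldNormedType.Exports.
Local Open Scope classical_set_scope.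
Local Open Scope ring_scope.

(* Identify a vector [z] of [R^n] with the step function [psi z]. Then [psi] intertwines
   the shift operator [D_n] with the integral operator of the step graphon of [n D_n], and
   it commutes with [rho] on [[0, 1[]. It therefore suffices that the class of sequences
   [z_n] whose images [psi z_n] are Cauchy in [L^2] be stable under every operation of a
   layer. Stability under [D_n] holds because [T_(W_n)] tends to the bounded operator [T_W],
   hence so does stability under [p(D_n)] for a polynomial [p]. The entries of [n D_n] are
   bounded by some [C], so all spectra lie in [[-C, C]]; approximating [h] there by a
   polynomial [p] and using [||(h - p)(D_n)|| <= sup_[-C, C] |h - p|], which is the spectral
   theorem, gives stability under [h(D_n)]. Only Cauchy sequences occur, so neither the
   functional calculus of [T_W] nor the completeness of [L^2] is needed. *)

(** * Spectral bound for polynomials of symmetric matrices *)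

Section Spectral.
Variable R : realType.
Local Notation toC := (real_complex R).

Lemma unitarymx_sumsq (C : numClosedFieldType) (n : nat) (P : 'M[C]_n) (x : 'cV[C]_n) :
  P \is unitarymx ->
  \sum_i `|(P *m x) i ord0| ^+ 2 = \sum_i `|x i ord0| ^+ 2.
Proof.
have sumsqE (y : 'cV[C]_n) :
    \sum_i `|y i ord0| ^+ 2 = (map_mx Num.conj y^T *m y) ord0 ord0.
  by rewrite mxE; apply: eq_bigr => i _; rewrite !mxE normCK mulrC.
move=> Pu; rewrite !sumsqE trmx_mul map_mxM -mulmxA (mulmxA _ P).
have := Pu; rewrite -trmxC_unitary => /unitarymxP; rewrite trmxCK => ->.
by rewrite mul1mx.
Qed.

Lemma invmx_unitarymx (C : numClosedFieldType) (n : nat) (P : 'M[C]_n) :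
  P \is unitarymx -> invmx P \is unitarymx.
Proof. by move=> Pu; rewrite invmx_unitary // trmxC_unitary. Qed.

(** [eigenvalue] speaks of row vectors and [is_eigval] of column vectors. A real eigenvalue of the
    complexified matrix already has a real eigenvector, and symmetry allows it to be transposed. *)
Lemma spectrum_real_complex (n : nat) (D : 'M[R]_n) (a : R) :
  D^T = D -> eigenvalue (map_mx toC D) (toC a) -> is_eigval D a.
Proof.
move=> Dsym; rewrite eigenvalue_map => /eigenvalueP[v vE v0].
exists v^T; split; first by rewrite trmx_eq0.
by rewrite -[in LHS]Dsym -trmx_mul vE linearZ.
Qed.

(** Over the complex numbers [D] is [P^-1 diag(d) P] with [P] unitary, so [q(D)] is
    [P^-1 diag(q(d_j)) P]. Unitary factors preserve the sum of squares, and the diagonal one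
    multiplies each square by [|q(d_j)|^2]. *)
Lemma horner_mx_sumsq_le (n : nat) (D : 'M[R]_n.+1) (q : {poly R}) (c : R) :
  D^T = D -> (forall a, is_eigval D a -> `|q.[a]| <= c) ->
  forall v : 'cV[R]_n.+1,
  \sum_i ((horner_mx D q *m v) i ord0) ^+ 2 <= c ^+ 2 * \sum_i (v i ord0) ^+ 2.
Proof.
move=> Dsym qc v.
have Dh : map_mx toC D \is hermsymmx.
  apply: realsym_hermsym.
    by apply/is_hermitianmxP; rewrite expr0 scale1r map_mx_id // map_trmx Dsym.
  by apply/mxOverP => i j; rewrite mxE; apply/complex_realP; exists (D i j).
set Dc := map_mx toC D in Dh *.
set P := spectralmx Dc; set d := spectral_diag Dc.
have Pu : P \is unitarymx by exact: spectral_unitarymx.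
have Pun := unitarymx_unit Pu.
have DE : Dc = invmx P *m diag_mx d *m P.
  by apply/orthomx_spectralP/hermitian_normalmx.
(* Each [d_j] is real because [D] is Hermitian, and it is an eigenvalue with eigenvector [row j P],
   which is nonzero as [P] is invertible. *)
have dP j : exists2 a, d ord0 j = toC a & `|q.[a]| <= c.
  have /mxOverP/(_ ord0 j)/complex_realP[a da] := hermitian_spectral_diag_real Dh.
  exists a => //; apply: qc; apply: spectrum_real_complex => //.
  rewrite -da -[X in eigenvalue X]/Dc -/d; apply/eigenvalueP; exists (row j P).
    rewrite [X in _ *m X]DE -row_mul mulmxA mulmxA mulmxV // mul1mx mul_diag_mx.
    by apply/rowP => k; rewrite !mxE.
  apply/eqP => r0; have := congr1 (mulmx^~ (invmx P)) r0.
  rewrite -row_mul mulmxV // mul0mx => /rowP/(_ j).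
  by rewrite !mxE eqxx => /eqP; rewrite oner_eq0.
have sumsqC (w : 'cV[R]_n.+1) :
    toC (\sum_i (w i ord0) ^+ 2) = \sum_i `|map_mx toC w i ord0| ^+ 2.
  rewrite rmorph_sum; apply: eq_bigr => i _.
  by rewrite mxE rmorphXn -[RHS]normrX ger0_norm // -rmorphXn lecR sqr_ge0.
rewrite -lecR rmorphM /= !sumsqC map_mxM map_horner_mx -/Dc DE.
rewrite horner_mx_uconjC //.
rewrite -!mulmxA (unitarymx_sumsq _ _ _ _ (invmx_unitarymx _ _ _ Pu)).
rewrite -(unitarymx_sumsq _ _ P (map_mx toC v) Pu) mulr_sumr ler_sum // => i _.
set w := P *m _; set qC := map_poly _ q.
have -> : (horner_mx (diag_mx d) qC *m w) i ord0 = qC.[d ord0 i] * w i ord0.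
  by rewrite horner_mx_diag mul_diag_mx !mxE.
have [a -> qa] := dP i.
rewrite normrM exprMn ler_wpM2r ?exprn_ge0 // /qC.
rewrite horner_map -normrX -rmorphXn /= ger0_norm; last first.
  by rewrite ler0c sqr_ge0.
rewrite lecR -(ger0_norm (sqr_ge0 _)) normrX.
by rewrite ler_sqr ?nnegrE // (le_trans _ qa).
Qed.

(** Newton interpolation: the value at a new node [b] is corrected by a multiple of the product [q]
    that vanishes at all earlier nodes. *)
Lemma poly_interpolation (K : fieldType) (h : K -> K) (s : seq K) : uniq s ->
  exists p : {poly K}, forall a, a \in s -> p.[a] = h a.
Proof.
elim: s => [|b s IH] /=; first by exists 0.
move=> /andP[bs /IH[p ph]].
pose q := \prod_(c <- s) ('X - c%:P).
have qb : q.[b] != 0 by rewrite -[_ == 0]/(root q b) root_prod_XsubC.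
exists (p + ((h b - p.[b]) / q.[b]) *: q) => a; rewrite inE !hornerE.
have [-> _|_ /= sa] := eqVneq a b; first by field.
have /rootP -> : root q a by rewrite root_prod_XsubC.
by rewrite mulr0 addr0 ph.
Qed.

Lemma poly_mx_horner (n : nat) (p : {poly R}) (D : 'M[R]_n.+1) :
  poly_mx p D = horner_mx D p.
Proof.
rewrite /poly_mx -[in RHS](coefK p) poly_def rmorph_sum.
apply: eq_bigr => i _ /=; rewrite horner_mxZ rmorphXn /= horner_mx_X; congr (_ *: _).
by elim: (val i) => //= k ->; rewrite exprS.
Qed.

Lemma is_eigval_root (n : nat) (D : 'M[R]_n) (a : R) :
  is_eigval D a -> root (char_poly D^T) a.
Proof.
move=> [v [v0 vE]]; rewrite -eigenvalue_root_char; apply/eigenvalueP.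
by exists v^T; rewrite ?trmx_eq0 // -trmx_mul vE linearZ.
Qed.

(** The spectrum lies among the finitely many roots of the characteristic polynomial, so an
    interpolating polynomial exists and [xget] returns a genuine member of its set instead of the
    default [0]. *)
Lemma matfunP (n : nat) (h : R -> R) (D : 'M[R]_n) :
  exists2 p : {poly R}, (forall a, is_eigval D a -> p.[a] = h a) &
    matfun h D = poly_mx p D.
Proof.
have cn0 : char_poly D^T != 0 by rewrite monic_neq0 // char_poly_monic.
pose s := undup (rootsR (char_poly D^T)).
have sD a : is_eigval D a -> a \in s.
  by move=> /is_eigval_root Da; rewrite mem_undup -(roots_on_rootsR cn0 a) in_itv.
have [p ph] := poly_interpolation _ h s (undup_uniq _).
have : [set B | exists p : {poly R},
     (forall a, is_eigval D a -> p.[a] = h a) /\ B = poly_mx p D] (matfun h D).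
  by apply: (@xgetPex _ 0); exists (poly_mx p D), p; split => // a /sD /ph.
by move=> [q [qh ->]]; exists q.
Qed.

(** The eigenvalue equation is read at a coordinate where [|v i|] is maximal: after scaling by [n],
    the row sum has [n] terms, each at most [C * |v i|]. *)
Lemma is_eigval_bound (n : nat) (D : 'M[R]_n) (C a : R) :
  (forall i j, `|(n%:R *: D) i j| <= C) -> is_eigval D a -> `|a| <= C.
Proof.
case: n D => [|n] D DC [v [v0 vE]].
  by move/eqP: v0; case; apply/matrixP => -[].
have [i0 vi0] : exists i, v i ord0 != 0.
  apply/existsP; rewrite -negb_forall; apply: contra v0 => /forallP v0.
  by apply/eqP/matrixP => i j; rewrite ord1 mxE; apply/eqP.
have [i _ iM] := Order.TotalTheory.arg_maxP (fun i => `|v i ord0|) (isT : xpredT i0).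
have vi : 0 < `|v i ord0| by rewrite (lt_le_trans _ (iM i0 isT)) // normr_gt0.
have n0 : 0 < n.+1%:R :> R by rewrite ltr0n.
rewrite -(ler_pM2r vi) -normrM; have := congr1 (fun w : 'cV_n.+1 => w i ord0) vE.
rewrite [RHS]mxE => <-; rewrite mxE -(ler_pM2l n0) -[X in X * `|_|](ger0_norm (ltW n0)).
rewrite -normrM mulr_sumr (le_trans (ler_norm_sum _ _ _)) //.
have -> : n.+1%:R * (C * `|v i ord0|) = \sum_(j < n.+1) C * `|v i ord0|.
  by rewrite sumr_const card_ord mulr_natl.
apply: ler_sum => j _.
rewrite mulrA normrM ler_pM ?iM //.
  by have := DC i j; rewrite mxE.
exact: (iM j isT).
Qed.

End Spectral.

(** * Weierstrass approximation by Bernstein polynomials *)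

Section Weierstrass.
Variable R : realType.

(* The expectation of [g] under the binomial law of parameters [n] and ['X]. *)
Fixpoint bernstein (n : nat) (g : nat -> R) : {poly R} :=
  if n is m.+1 then 'X * bernstein m (g \o succn) + (1 - 'X) * bernstein m g
  else (g 0)%:P.

(* [(n t - c)^2 + n t (1 - t)] is the second moment about [c] of the binomial law. *)
Lemma bernstein_dist (n : nat) (g : nat -> R) (t a e K c : R) : 0 <= t <= 1 ->
  (forall k, (k <= n)%N -> `|g k - a| <= e + K * (k%:R - c) ^+ 2) ->
  `|(bernstein n g).[t] - a| <= e + K * ((n%:R * t - c) ^+ 2 + n%:R * (t * (1 - t))).
Proof.
move=> /andP[t0 t1]; elim: n g c => [|n IH] g c gK /=.
  by have := gK 0%N isT; rewrite hornerC !mul0r addr0.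
set u := (bernstein n (g \o succn)).[t]; set w := (bernstein n g).[t].
have -> : ('X * bernstein n (g \o succn) + (1 - 'X) * bernstein n g).[t] =
    t * u + (1 - t) * w by rewrite !hornerE.
(* Conditioning on one trial: a success shifts [g] by one, which amounts to moving the centre from
   [c] to [c - 1]; a failure leaves both unchanged. *)
have H1 : `|u - a| <= e + K * ((n%:R * t - (c - 1)) ^+ 2 + n%:R * (t * (1 - t))).
  by apply: IH => k kn; rewrite opprB addrA natr1; exact: (gK k.+1 kn).
have H2 : `|w - a| <= e + K * ((n%:R * t - c) ^+ 2 + n%:R * (t * (1 - t))).
  by apply: IH => k kn; apply: gK; rewrite ltnW.
have -> : t * u + (1 - t) * w - a = t * (u - a) + (1 - t) * (w - a) by ring.
rewrite (le_trans (ler_normD _ _)) // !normrM (ger0_norm t0).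
rewrite (@ger0_norm _ (1 - t)) ?subr_ge0 //.
apply: (@le_trans _ _ (t * (e + K * ((n%:R * t - (c - 1)) ^+ 2 + n%:R * (t * (1 - t)))) +
  (1 - t) * (e + K * ((n%:R * t - c) ^+ 2 + n%:R * (t * (1 - t)))))).
  by apply: lerD; apply: ler_wpM2l; rewrite ?subr_ge0.
rewrite -(natr1 n) le_eqVlt; apply/orP; left; apply/eqP; ring.
Qed.

(** Uniform continuity gives [e] when [|a - b| < d]; otherwise [(a - b)^2 / d^2] is at least 1 and
    multiplies the crude bound [2 * M]. The quadratic form is the one that [bernstein_dist]
    accepts. *)
Lemma continuous_modulus (h : R -> R) (C e : R) : continuous h -> 0 < e ->
  exists2 K : R, 0 <= K & forall a b, `|a| <= C -> `|b| <= C ->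
    `|h a - h b| <= e + K * (a - b) ^+ 2.
Proof.
move=> hc e0.
have Ccompact := @segment_compact R (- C) C.
have [M M0 hM] : exists2 M : R, 0 <= M & forall a, `|a| <= C -> `|h a| <= M.
  have : compact (h @` `[- C, C]).
    by apply: continuous_compact => //; exact: continuous_subspaceT.
  move=> /compact_bounded[M [_ hM]]; exists (`|M| + 1); first by rewrite addr_ge0.
  move=> a aC; apply: (hM (`|M| + 1)); first by rewrite ltr_pwDr // ler_norm.
  by exists a => //=; rewrite in_itv /= -ler_norml.
have [d d0 hd] : exists2 d : R, 0 < d & forall a b, `|a| <= C -> `|a - b| < d ->
    `|h a - h b| <= e.
  have /compact_near_coveringP Cnc := Ccompact.
  (* Near each point some [d] works, by halving a radius of continuity; the covering form of
     compactness then yields one [d] for the whole segment. *)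
  have near_a a : `[- C, C]%classic a ->
      \forall a' \near a & d \near 0^'+, forall b, `|a' - b| < d -> `|h a' - h b| <= e.
    move=> _.
    have /cvgrPdist_lt/(_ _ (divr_gt0 e0 (ltr0Sn _ 1))) := hc a.
    move=> /nbhs_ballP[r /= r0 hr].
    exists (ball a (r / 2), [set d | d < r / 2]).
      split; first by apply: nbhsx_ballx; rewrite divr_gt0.
      by apply: nbhs_right_lt; rewrite divr_gt0.
    move=> [a' d] /= [aa' dr] b ba'.
    have ha' : `|h a - h a'| < e / 2.
      by apply: hr; apply: le_ball aa'; lra.
    have hb : `|h a - h b| < e / 2.
      apply: hr; rewrite (splitr r) /ball /=.
      rewrite (le_lt_trans (ler_distD a' _ _)) // ltrD //.
      by rewrite (lt_trans ba').
    rewrite (le_trans (ler_distD (h a) _ _)) // [leRHS](splitr e) lerD // ltW //.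
    by rewrite distrC.
  have H := Cnc R (0^'+) (fun d a => forall b, `|a - b| < d -> `|h a - h b| <= e) (at_right_proper_filter 0) near_a.
  have [d [d0 Hd]] : exists d, 0 < d /\ (`[- C, C] `<=` fun a => forall b, `|a - b| < d -> `|h a - h b| <= e).
    by have := filter_ex (filterI (nbhs_right_gt 0) H); move=> [d [? ?]]; exists d.
  by exists d => // a b aC; apply: Hd; rewrite /= in_itv /= -ler_norml.
have K0 : 0 <= 2 * M / d ^+ 2 by rewrite divr_ge0 ?sqr_ge0 // mulr_ge0.
exists (2 * M / d ^+ 2) => // a b aC bC.
have [ab|ab] := ltP `|a - b| d.
  by rewrite (le_trans (hd _ _ aC ab)) // lerDl mulr_ge0 // sqr_ge0.
rewrite (le_trans (ler_normB _ _)) // (le_trans (lerD (hM _ aC) (hM _ bC))) //.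
rewrite (@le_trans _ _ (2 * M / d ^+ 2 * (a - b) ^+ 2)) ?lerDr ?(ltW e0) //.
have ratio_ge1 : 1 <= (a - b) ^+ 2 / d ^+ 2.
  rewrite ler_pdivlMr ?exprn_gt0 // mul1r -[leRHS]ger0_norm ?sqr_ge0 // normrX.
  by rewrite ler_sqr ?nnegrE // ltW.
have -> : 2 * M / d ^+ 2 * (a - b) ^+ 2 = 2 * M * ((a - b) ^+ 2 / d ^+ 2) by ring.
nra.
Qed.

Lemma weierstrass_approximation (h : R -> R) (C e : R) : continuous h -> 0 < e ->
  exists p : {poly R}, forall a, `|a| <= C -> `|p.[a] - h a| <= e.
Proof.
move=> hc e0.
wlog C0 : C / 0 < C.
  move=> H; have [p pP] := H (`|C| + 1) (ltr_pwDr ltr01 (normr_ge0 _)).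
  by exists p => a aC; apply: pP; rewrite (le_trans aC) // (le_trans (ler_norm _)) ?lerDl.
have [K K0 hK] := continuous_modulus h C (e / 2) hc (divr_gt0 e0 (ltr0Sn _ 1)).
(* This degree makes the variance term [K * (2 * C)^2 / n] at most [e / 2]. *)
pose n := (Num.truncn (K * (2 * C) ^+ 2 / (e / 2))).+1.
have n0 : 0 < n%:R :> R by rewrite ltr0n.
pose node k := 2 * C * (k%:R / n%:R) - C.
(* The affine substitution maps [[-C, C]] onto [[0, 1]], and [node] sends the grid points [k / n]
   back to [[-C, C]]. *)
exists (bernstein n (h \o node) \Po ((2 * C)^-1 *: 'X + (1 / 2)%:P)) => a aC.
rewrite horner_comp; pose t := (2 * C)^-1 * a + 1 / 2.
have -> : ((2 * C)^-1 *: 'X + (1 / 2)%:P).[a] = t.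
  by rewrite hornerD hornerZ hornerX hornerC.
have aE : a = 2 * C * t - C by rewrite /t; field; rewrite gt_eqF.
have t01 : 0 <= t <= 1.
  have := aC; rewrite ler_norml aE => /andP[l r]; apply/andP; split; nra.
(* Centring at the mean [n * t] kills the squared bias and leaves only the variance
   [n * t * (1 - t)]. *)
have := bernstein_dist n (h \o node) t (h a) (e / 2) (K * (2 * C / n%:R) ^+ 2) (n%:R * t) t01.
move=> /(_ _)/le_trans; apply.
  move=> k kn /=; have nodeC : `|node k| <= C.
    have : 0 <= (k%:R / n%:R : R) <= 1.
      by rewrite divr_ge0 //= ler_pdivrMr // mul1r ler_nat.
    rewrite /node; set z : R := k%:R / n%:R => /andP[z0 z1].
    by rewrite ler_norml; apply/andP; split; nra.
  rewrite (le_trans (hK _ _ nodeC aC)) // lerD2l aE le_eqVlt; apply/orP; left; apply/eqP.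
  by rewrite /node; field; rewrite gt_eqF.
rewrite subrr expr0n /= add0r [leRHS](splitr e) lerD2l.
have -> : K * (2 * C / n%:R) ^+ 2 * (n%:R * (t * (1 - t))) =
  K * (2 * C) ^+ 2 / n%:R * (t * (1 - t)) by field; rewrite gt_eqF.
rewrite (@le_trans _ _ (K * (2 * C) ^+ 2 / n%:R)) //.
  rewrite ler_piMr ?divr_ge0 ?mulr_ge0 ?(ltW C0) //.
  by move: t01 => /andP[? ?]; nra.
rewrite ler_pdivrMr // [leRHS]mulrC -ler_pdivrMr ?divr_gt0 //.
exact/ltW/truncnS_gt.
Qed.
End Weierstrass.

(** * Square-integrable functions on the unit interval *)

Section L2.
Variable R : realType.
Local Notation mu := (@lebesgue_measure R).
Local Notation I := (@I01 R).
Local Notation integrable01 f := (mu.-integrable I (EFin \o f)).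
Implicit Types (f g : R -> R) (W : R -> R -> R) (c : R).

(* The same sigma-algebra is seen through two displays, one on [R] and one on
   [measurableTypeR R], the carrier of [mu]. *)
Lemma measurable_I01 : measurable (I : set (measurableTypeR R)).
Proof. exact: measurable_itv. Qed.
Lemma measurable_I01R : measurable (I : set R).
Proof. exact: measurable_itv. Qed.
Local Hint Resolve measurable_I01 measurable_I01R : core.

Lemma lebesgue_I01 : mu I = 1%:E.
Proof. by rewrite lebesgue_measure_itv /= lte_fin ltr01 sube0. Qed.

Lemma integral01_cst c : \int[mu]_(u in I) c = c.
Proof. by rewrite Rintegral_cst // [X in fine X]lebesgue_I01 mulr1. Qed.

Lemma bounded_integrable f c : measurable_fun I f ->
  (forall u, I u -> `|f u| <= c) -> integrable01 f.
Proof.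
move=> mf fc; apply: measurable_bounded_integrable => //.
  by rewrite [ltLHS]lebesgue_I01 ltry.
exists c; split; first exact: num_real.
by move=> x cx u Iu /=; rewrite (le_trans (fc _ Iu)) // ltW.
Qed.

Lemma integrable01D f g : integrable01 f -> integrable01 g ->
  integrable01 (fun u => f u + g u).
Proof. by move=> fi gi; have := integrableD measurable_I01 fi gi. Qed.

Lemma integrable01Z f c : integrable01 f -> integrable01 (fun u => c * f u).
Proof. by move=> fi; have := integrableZl measurable_I01 c fi. Qed.

Lemma le_integrable01 f g : measurable_fun I f ->
  (forall u, I u -> `|f u| <= g u) -> integrable01 g -> integrable01 f.
Proof.
move=> mf fg; apply: le_integrable => //; first exact/measurable_EFinP.
by move=> u Iu /=; rewrite lee_fin (le_trans (fg _ Iu)) // ler_norm.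
Qed.

Lemma inL2_sqr f : inL2 f -> integrable01 (fun u => f u ^+ 2).
Proof.
move=> [mf fi]; apply/integrableP; split.
  by apply/measurable_EFinP; exact: measurable_funX.
apply: le_lt_trans fi; rewrite le_eqVlt; apply/orP; left; apply/eqP.
by apply: eq_integral => u _ /=; rewrite ger0_norm // sqr_ge0.
Qed.

Lemma inL2P f : measurable_fun I f -> integrable01 (fun u => f u ^+ 2) -> inL2 f.
Proof.
move=> mf /integrableP[_ fi]; split => //; apply: le_lt_trans fi.
rewrite le_eqVlt; apply/orP; left; apply/eqP; apply: eq_integral => u _ /=.
by rewrite ger0_norm // sqr_ge0.
Qed.

Lemma inL2_measurable f : inL2 f -> measurable_fun I f.
Proof. by case. Qed.

(** [|f| <= 1 + f^2], and constants are integrable on the unit interval. *)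
Lemma inL2_integrable f : inL2 f -> integrable01 f.
Proof.
move=> fL; apply: (@le_integrable01 _ (fun u => 1 + f u ^+ 2)).
- exact: inL2_measurable.
- by move=> u _; rewrite ler_norml; apply/andP; split; nra.
- apply: integrable01D; last exact: inL2_sqr.
  by apply: (@bounded_integrable _ 1) => // u _; rewrite normr1.
Qed.

Lemma inL2_bounded f c : measurable_fun I f -> (forall u, I u -> `|f u| <= c) -> inL2 f.
Proof.
move=> mf fc; apply: inL2P => //; apply: (@bounded_integrable _ (c ^+ 2)).
  exact: measurable_funX.
by move=> u Iu; rewrite normrX ler_sqr ?nnegrE ?(le_trans _ (fc _ Iu)) // fc.
Qed.

Lemma inL2D f g : inL2 f -> inL2 g -> inL2 (fun u => f u + g u).
Proof.
move=> fL gL; have [mf mg] := (inL2_measurable _ fL, inL2_measurable _ gL).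
have mfg : measurable_fun I (fun u => f u + g u) by exact: measurable_funD.
apply: inL2P => //; apply: (@le_integrable01 _ (fun u => 2 * f u ^+ 2 + 2 * g u ^+ 2)).
- exact: measurable_funX.
- by move=> u _; rewrite ger0_norm ?sqr_ge0 //; have := sqr_ge0 (f u - g u); nra.
- by apply: integrable01D; apply: integrable01Z; exact: inL2_sqr.
Qed.

Lemma inL2Z f c : inL2 f -> inL2 (fun u => c * f u).
Proof.
move=> fL; apply: inL2P.
  by apply: measurable_funM => //; exact: inL2_measurable.
have := integrable01Z _ (c ^+ 2) (inL2_sqr _ fL).
by under [X in _ -> integrable01 X]eq_fun do rewrite exprMn.
Qed.

Lemma inL2B f g : inL2 f -> inL2 g -> inL2 (fun u => f u - g u).
Proof.
move=> fL gL; have := inL2D _ _ fL (inL2Z _ (-1) gL).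
by under eq_fun do rewrite mulN1r.
Qed.

Lemma L2norm_ge0 f : 0 <= L2norm f.
Proof. exact: sqrtr_ge0. Qed.

Lemma L2norm_sqr f : L2norm f ^+ 2 = \int[mu]_(u in I) (f u ^+ 2).
Proof. by rewrite sqr_sqrtr //; apply: Rintegral_ge0 => u _; exact: sqr_ge0. Qed.

Lemma L2norm_le f c : 0 <= c ->
  \int[mu]_(u in I) (f u ^+ 2) <= c ^+ 2 -> L2norm f <= c.
Proof. by move=> c0; rewrite -L2norm_sqr ler_sqr ?nnegrE ?L2norm_ge0. Qed.

Lemma eq_L2norm f g : (forall u, I u -> f u = g u) -> L2norm f = L2norm g.
Proof.
move=> fg; rewrite /L2norm; congr (Num.sqrt (fine _)).
by apply: eq_integral => u; rewrite inE => Iu; rewrite fg.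
Qed.

Lemma le_L2norm f g : inL2 f -> inL2 g -> (forall u, I u -> `|f u| <= `|g u|) ->
  L2norm f <= L2norm g.
Proof.
move=> fL gL fg; apply: L2norm_le; first exact: L2norm_ge0.
rewrite L2norm_sqr; apply: le_Rintegral => //; try exact: inL2_sqr.
move=> u Iu; rewrite -[leLHS]ger0_norm ?sqr_ge0 // -[leRHS]ger0_norm ?sqr_ge0 //.
by rewrite !normrX ler_sqr ?nnegrE // fg.
Qed.

Lemma L2normZ f c : inL2 f -> L2norm (fun u => c * f u) = `|c| * L2norm f.
Proof.
move=> fL; rewrite -(ger0_norm (L2norm_ge0 _)) -sqrtr_sqr L2norm_sqr.
rewrite (_ : (fun u => _) = (fun u => c ^+ 2 * f u ^+ 2)); last first.
  by apply/funext => u; rewrite exprMn.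
rewrite RintegralZl //; last exact: inL2_sqr.
by rewrite -L2norm_sqr -exprMn sqrtr_sqr normrM (ger0_norm (L2norm_ge0 _)).
Qed.

Lemma L2norm_bounded f c : measurable_fun I f -> 0 <= c ->
  (forall u, I u -> `|f u| <= c) -> L2norm f <= c.
Proof.
move=> mf c0 fc; apply: L2norm_le => //.
rewrite (@le_trans _ _ (\int[mu]_(u in I) (c ^+ 2))) //; last first.
  by rewrite integral01_cst.
apply: le_Rintegral => //; first by apply: inL2_sqr; exact: inL2_bounded fc.
  by apply: (@bounded_integrable _ (`|c ^+ 2|)).
move=> u Iu; rewrite -[leLHS]ger0_norm ?sqr_ge0 // normrX.
by rewrite ler_sqr ?nnegrE // fc.
Qed.

(* The constant 2 spares the Cauchy-Schwarz inequality and is harmless for convergence. *)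
Lemma L2normD f g : inL2 f -> inL2 g ->
  L2norm (fun u => f u + g u) <= 2 * (L2norm f + L2norm g).
Proof.
move=> fL gL; have [f0 g0] := (L2norm_ge0 f, L2norm_ge0 g).
apply: L2norm_le; first by rewrite mulr_ge0 ?addr_ge0.
have [f2 g2] := (inL2_sqr _ fL, inL2_sqr _ gL).
rewrite (@le_trans _ _ (\int[mu]_(u in I) (2 * f u ^+ 2 + 2 * g u ^+ 2))) //.
  apply: le_Rintegral => //; first exact/inL2_sqr/inL2D.
    by apply: integrable01D; exact: integrable01Z.
  by move=> u _; have := sqr_ge0 (f u - g u); nra.
rewrite RintegralD //; try exact: integrable01Z.
rewrite !RintegralZl // -!L2norm_sqr; nra.
Qed.

Lemma L2norm_triangle f g h : inL2 f -> inL2 g -> inL2 h ->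
  L2norm (fun u => f u - h u) <=
  2 * (L2norm (fun u => f u - g u) + L2norm (fun u => g u - h u)).
Proof.
move=> fL gL hL; rewrite -(eq_L2norm (fun u => (f u - g u) + (g u - h u))).
  by apply: L2normD; exact: inL2B.
by move=> u _; rewrite addrA subrK.
Qed.

Lemma L2norm_triangle4 f g h k : inL2 f -> inL2 g -> inL2 h -> inL2 k ->
  L2norm (fun u => f u - k u) <= 2 * L2norm (fun u => f u - g u) +
    4 * L2norm (fun u => g u - h u) + 4 * L2norm (fun u => h u - k u).
Proof.
move=> fL gL hL kL; have := L2norm_triangle _ _ _ fL gL kL.
have := L2norm_triangle _ _ _ gL hL kL; lra.
Qed.

Lemma L2norm_distC f g : L2norm (fun u => f u - g u) = L2norm (fun u => g u - f u).
Proof.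
rewrite /L2norm; congr (Num.sqrt (fine _)); apply: eq_integral => u _.
by rewrite -sqrrN opprB.
Qed.

Lemma integral_abs_le_L2norm f : inL2 f -> \int[mu]_(u in I) `|f u| <= L2norm f.
Proof.
move=> fL; set a := \int[mu]_(u in I) `|f u|.
have a0 : 0 <= a by apply: Rintegral_ge0.
rewrite -ler_sqr ?nnegrE ?L2norm_ge0 // L2norm_sqr.
have fa : integrable01 (fun u => `|f u|).
  exact: (integrable_norm (inL2_integrable _ fL)).
have fs := inL2_sqr _ fL.
have i1 c : integrable01 (fun=> c) by exact: (@bounded_integrable _ `|c|).
(* [0 <= \int (|f| - a)^2 = \int f^2 - a^2] *)
have : 0 <= \int[mu]_(u in I) (f u ^+ 2 + (- 2 * a * `|f u| + a ^+ 2)).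
  apply: Rintegral_ge0 => u _.
  rewrite (_ : _ + _ = (`|f u| - a) ^+ 2) ?sqr_ge0 //.
  by rewrite -(real_normK (num_real (f u))); ring.
rewrite RintegralD //; last by apply: integrable01D => //; exact: integrable01Z.
rewrite RintegralD //; last exact: integrable01Z.
rewrite RintegralZl // integral01_cst -/a; nra.
Qed.

End L2.

(** * Step functions and graphon operators *)

Section Step.
Variable R : realType.
Local Notation mu := (@lebesgue_measure R).
Local Notation I := (@I01 R).
Local Notation integrable01 f := (mu.-integrable I (EFin \o f)).
Implicit Types (f g : R -> R) (W : R -> R -> R) (c : R).
Local Hint Resolve measurable_I01 measurable_I01R : core.

Lemma chiP_disjoint (n i j : nat) (u : R) : chiP n i u != 0 -> chiP n j u != 0 -> i = j.
Proof.
(* For [n = 0] both endpoints of the cell are [0], since [0^-1 = 0], so [chiP] vanishes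
   identically. *)
have [->|n0] := posnP n; first by rewrite /chiP invr0 !mulr0 leNgt; case: ltP; rewrite ?eqxx.
have lt_succ k l : k%:R / n%:R <= u -> u < l.+1%:R / n%:R -> (k <= l)%N.
  move=> ku ul; have := le_lt_trans ku ul.
  by rewrite ltr_pM2r ?invr_gt0 ?ltr0n // ltr_nat ltnS.
rewrite /chiP; case: ifP => [/andP[iu ui] _|_]; last by rewrite eqxx.
case: ifP => [/andP[ju uj] _|_]; last by rewrite eqxx.
by apply/eqP; rewrite eqn_leq (lt_succ _ _ iu uj) (lt_succ _ _ ju ui).
Qed.

(** The cells are disjoint, so at a given [u] every step function reads off the same coordinate [j],
    or all of them vanish. As [j] does not depend on [x], pointwise identities between step
    functions become identities between coordinates. *)
Lemma psi_eval (n : nat) (u : R) :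
  (exists j : 'I_n, forall x, psi x u = x j) \/ (forall x : 'I_n -> R, psi x u = 0).
Proof.
have [[j ju]|noj] := pselect (exists j : 'I_n, chiP n j u != 0); last first.
  right=> x; apply: big1 => j _; have [->|ju] := eqVneq (chiP n j u) 0.
    by rewrite mulr0.
  by case: noj; exists j.
left; exists j => x; rewrite /psi (bigD1 j) //= big1 ?addr0.
  by move: ju; rewrite /chiP; case: ifP => _; rewrite ?eqxx // mulr1.
move=> i ij; have [->|iu] := eqVneq (chiP n i u) 0; first by rewrite mulr0.
by case/eqP: ij; apply/val_inj; exact: chiP_disjoint iu ju.
Qed.

Lemma chiP_indic (n j : nat) : @chiP R n j = \1_(`[j%:R / n%:R, j.+1%:R / n%:R[).
Proof.
by apply/funext => u; rewrite /chiP indicE mem_setE in_itv /=; case: ifP.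
Qed.

Lemma measurable_chiP (n j : nat) : measurable_fun I (@chiP R n j).
Proof.
rewrite chiP_indic; apply: (@measurable_indic _ _ _ _ (`[_, _[%classic : set R)).
exact: measurable_itv.
Qed.

Lemma integral_chiP (n j : nat) : (j < n)%N -> \int[mu]_(u in I) chiP n j u = n%:R^-1.
Proof.
move=> jn; have n0 : 0 < n%:R :> R by rewrite ltr0n (leq_ltn_trans _ jn).
rewrite chiP_indic /Rintegral integral_indic //.
rewrite setIidl; last first.
  move=> u /=; rewrite /I01 /= !in_itv /= => /andP[l r]; apply/andP; split.
    by rewrite (le_trans _ l) // divr_ge0 // ltW.
  by rewrite (le_trans (ltW r)) // ler_pdivrMr // mul1r ler_nat.
rewrite [X in fine X](lebesgue_measure_itv `[_, _[) /= lte_fin ltr_pM2r ?invr_gt0 // ltr_nat ltnSn /=.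
by rewrite -mulrBl -natr1 addrAC subrr add0r mul1r.
Qed.

Lemma measurable_psi (n : nat) (x : 'I_n -> R) : measurable_fun I (psi x).
Proof.
by apply: measurable_sum => j; apply: measurable_funM => //; exact: measurable_chiP.
Qed.

Lemma psi_bounded (n : nat) (x : 'I_n -> R) (u : R) : `|psi x u| <= \sum_j `|x j|.
Proof.
have [[j ->]|->] := psi_eval n u; last by rewrite normr0 sumr_ge0.
by rewrite (bigD1 j) //= lerDl sumr_ge0.
Qed.

Lemma inL2_psi (n : nat) (x : 'I_n -> R) : inL2 (psi x).
Proof. by apply: inL2_bounded (measurable_psi _ x) _ => u _; exact: psi_bounded. Qed.

Lemma integral_psi (n : nat) (x : 'I_n -> R) :
  \int[mu]_(u in I) psi x u = n%:R^-1 * \sum_j x j.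
Proof.
have chii (j : 'I_n) : integrable01 (fun u => x j * chiP n j u).
  apply: integrable01Z; apply: (@bounded_integrable _ _ 1); first exact: measurable_chiP.
  by move=> u _; rewrite /chiP; case: ifP; rewrite ?normr1 // normr0.
rewrite /psi mulr_sumr.
(* Integrability and the value of the integral are carried together through an induction on an
   arbitrary list of indices. *)
suff H (s : seq 'I_n) : integrable01 (fun u => \sum_(j <- s) x j * chiP n j u) /\
    \int[mu]_(u in I) (\sum_(j <- s) x j * chiP n j u) = \sum_(j <- s) n%:R^-1 * x j.
  by have [_] := H (index_enum 'I_n).
elim: s => [|j s [si IH]].
  rewrite big_nil (@eq_Rintegral _ _ _ mu I (fun=> 0)) ?integral01_cst; last first.
    by move=> u _; rewrite big_nil.
  split=> //; under eq_fun do rewrite big_nil.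
  by apply: (@bounded_integrable _ _ 0) => // u _; rewrite normr0.
have consE : (fun u => \sum_(k <- j :: s) x k * chiP n k u) =
    (fun u => x j * chiP n j u + \sum_(k <- s) x k * chiP n k u).
  by apply/funext => u; rewrite big_cons.
split; first by rewrite consE; exact: integrable01D.
rewrite consE RintegralD // IH big_cons RintegralZl //.
  by rewrite integral_chiP // mulrC.
apply: (@bounded_integrable _ _ 1); first exact: measurable_chiP.
by move=> u _; rewrite /chiP; case: ifP; rewrite ?normr1 // normr0.
Qed.

Lemma L2norm_psi (n : nat) (x : 'I_n -> R) :
  L2norm (psi x) ^+ 2 = n%:R^-1 * \sum_j x j ^+ 2.
Proof.
rewrite L2norm_sqr -integral_psi; apply: eq_Rintegral => u _.
by have [[j H]|H] := psi_eval n u; rewrite !H // expr0n.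
Qed.

Lemma psiB (n : nat) (x y : 'I_n -> R) (u : R) :
  psi (fun i => x i - y i) u = psi x u - psi y u.
Proof. by have [[j H]|H] := psi_eval n u; rewrite !H // subr0. Qed.

Lemma psiZ (n : nat) (c : R) (x : 'I_n -> R) (u : R) :
  psi (fun i => c * x i) u = c * psi x u.
Proof. by have [[j H]|H] := psi_eval n u; rewrite !H // mulr0. Qed.

(** Nesting two step functions lets [psi_eval] be applied to each variable in turn. *)
Lemma stepW_psi (n : nat) (B : 'M[R]_n) (v u : R) :
  stepW B v u = psi (fun i => psi (B i) u) v.
Proof.
apply: eq_bigr => i _; rewrite /psi mulr_suml; apply: eq_bigr => j _.
by rewrite mulrAC.
Qed.

(** The factor [n] between shift operator and weight matrix cancels the cell length [1 / n]. *)
Lemma TW_step (n : nat) (D : 'M[R]_n) (x : 'I_n -> R) (v : R) : (0 < n)%N ->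
  TW (stepW (n%:R *: D)) (psi x) v = psi (fun i => \sum_j D i j * x j) v.
Proof.
move=> n0; rewrite /TW -/(Rintegral _ _ _).
have [[i H]|H] := psi_eval n v; last first.
  rewrite H (@eq_Rintegral _ _ _ mu I (fun=> 0)) ?integral01_cst // => u _.
  by rewrite stepW_psi H mul0r.
rewrite H (@eq_Rintegral _ _ _ mu I (psi (fun j => (n%:R *: D) i j * x j))).
  rewrite integral_psi mulr_sumr; apply: eq_bigr => j _; rewrite mxE -mulrA mulKf //.
  by rewrite pnatr_eq0 -lt0n.
move=> u _; rewrite stepW_psi H.
by have [[j K]|K] := psi_eval n u; rewrite !K // mul0r.
Qed.

End Step.

(** * Integral operators of bounded measurable kernels *)

Section Graphon.
Variable R : realType.
Local Notation mu := (@lebesgue_measure R).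
Local Notation I := (@I01 R).
Local Notation integrable01 f := (mu.-integrable I (EFin \o f)).
Variables (W : R -> R -> R) (C : R).
Hypothesis mW : measurable_fun (I `*` I) (fun p : R * R => W p.1 p.2).
Hypothesis WC : forall u v, I u -> I v -> `|W u v| <= C.
Implicit Types f g : R -> R.
Local Hint Resolve measurable_I01 measurable_I01R : core.

Let measurableII : measurable (I `*` I : set (R * R)).
Proof. exact: measurableX. Qed.

Lemma graphon_bound_ge0 : 0 <= C.
Proof.
have I0 : I 0 by rewrite /I01 /= in_itv /= lexx ler01.
exact: le_trans (WC _ _ I0 I0).
Qed.

Lemma graphon_section (v : R) : I v -> measurable_fun I (W v).
Proof.
move=> Iv; have /(measurable_restrictT _ measurableII) := mW.
move=> /measurable_fun_pair2 => /(_ v) H.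
apply: (eq_measurable_fun (fun u => (fun p : R * R => W p.1 p.2) \_ (I `*` I) (v, u))).
  move=> u; rewrite inE => Iu; rewrite patchE mem_set //.
exact: measurable_funTS.
Qed.

Lemma graphon_integrable f (v : R) : inL2 f -> I v ->
  integrable01 (fun u => W v u * f u).
Proof.
move=> fL Iv; apply: (@le_integrable01 _ _ (fun u => C * `|f u|)).
- by apply: measurable_funM; [exact: graphon_section|exact: inL2_measurable].
- by move=> u Iu; rewrite normrM ler_wpM2r // WC.
- by apply: integrable01Z; exact: (integrable_norm (inL2_integrable _ _ fL)).
Qed.

Lemma TWB f g (v : R) : inL2 f -> inL2 g -> I v ->
  TW W (fun u => f u - g u) v = TW W f v - TW W g v.
Proof.
move=> fL gL Iv; rewrite /TW -!/(Rintegral _ _ _).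
rewrite -RintegralB //; try exact: graphon_integrable.
by apply: eq_Rintegral => u _; rewrite mulrBr.
Qed.

Lemma TWZ f (c v : R) : inL2 f -> I v -> TW W (fun u => c * f u) v = c * TW W f v.
Proof.
move=> fL Iv; rewrite /TW -!/(Rintegral _ _ _).
rewrite -RintegralZl //; last exact: graphon_integrable.
by apply: eq_Rintegral => u _; rewrite mulrCA.
Qed.

(** [|T_W f|] is at most [C] times the integral of [|f|], hence at most [C * L2norm f]. This
    pointwise bound yields both square integrability and boundedness of [T_W]. *)
Lemma TW_bounded f (v : R) : inL2 f -> I v -> `|TW W f v| <= C * L2norm f.
Proof.
move=> fL Iv; rewrite /TW -/(Rintegral _ _ _).
have Wfi := graphon_integrable _ _ fL Iv.
have fi : integrable01 (fun u => `|f u|).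
  exact: (integrable_norm (inL2_integrable _ _ fL)).
apply: (@le_trans _ _ (\int[mu]_(u in I) `|W v u * f u|)).
  exact: le_normr_Rintegral.
apply: (@le_trans _ _ (\int[mu]_(u in I) (C * `|f u|))).
  apply: le_Rintegral => //; first exact: (integrable_norm Wfi).
    exact: integrable01Z.
  by move=> u Iu; rewrite normrM ler_wpM2r // WC.
rewrite RintegralZl // ler_wpM2l ?graphon_bound_ge0 //.
exact: integral_abs_le_L2norm.
Qed.

Lemma measurable_TW f : inL2 f -> measurable_fun I (TW W f).
Proof.
move=> fL; have mf := inL2_measurable _ _ fL.
pose F : R * R -> \bar R := (fun p => (W p.1 p.2 * f p.2)%:E) \_ (I `*` I).
have mF : measurable_fun setT F.
  apply/(measurable_restrictT _ measurableII)/measurable_EFinP.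
  apply: measurable_funM => //.
  move=> _ Y mY; have -> : I `*` I `&` (fun p : R * R => f p.2) @^-1` Y =
      I `*` (I `&` f @^-1` Y).
    by apply/seteqP; split => [p [[? ?] ?]|p [? [? ?]]].
  by apply: measurableX => //; exact: (mf (measurable_I01R R) Y mY).
(* With the integrand extended by zero to the plane, Tonelli applies to its positive and negative
   parts separately. *)
have mG : measurable_fun setT
    (fun v => \int[mu]_u (F^\+ (v, u)) - \int[mu]_u (F^\- (v, u)))%E.
  apply: emeasurable_funB.
    by apply: (measurable_fun_fubini_tonelli_F (m2 := mu)) => //; exact: measurable_funepos.
  by apply: (measurable_fun_fubini_tonelli_F (m2 := mu)) => //; exact: measurable_funeneg.
apply: (eq_measurable_fun
  (fun v => fine (\int[mu]_u (F^\+ (v, u)) - \int[mu]_u (F^\- (v, u)))%E)).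
  move=> v; rewrite inE => Iv; rewrite /TW; congr fine.
  rewrite [RHS]integral_mkcond [RHS]integralE; congr (_ - _)%E; apply: eq_integral => u _;
    by rewrite ?funeposE ?funenegE /F !patchE in_setX (mem_set Iv).
apply: measurable_funTS; exact: measurableT_comp.
Qed.

Lemma inL2_TW f : inL2 f -> inL2 (TW W f).
Proof.
move=> fL; apply: inL2_bounded (measurable_TW _ fL) _ => v Iv.
exact: TW_bounded fL Iv.
Qed.

Lemma L2norm_TW f : inL2 f -> L2norm (TW W f) <= C * L2norm f.
Proof.
move=> fL; apply: L2norm_bounded; first exact: measurable_TW.
  by rewrite mulr_ge0 ?graphon_bound_ge0 // L2norm_ge0.
by move=> v; exact: TW_bounded.
Qed.

(** The vector is rescaled into the unit ball by the a priori bound [K] rather than by its own norm,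
    which may vanish; linearity then restores the factor [K]. *)
Lemma opnorm_diff_psi (n : nat) (D : 'M[R]_n) (x : 'I_n -> R) (K e : R) :
  (0 < n)%N -> 0 < K -> L2norm (psi x) <= K ->
  (opnorm_diff (stepW (n%:R *: D)) W <= e%:E)%E ->
  L2norm (fun v => psi (fun i => (\sum_j D i j * x j)) v - TW W (psi x) v) <= K * e.
Proof.
move=> n0 K0 xK opE.
pose f := psi (fun j => K^-1 * x j).
have fE : f = fun u => K^-1 * psi x u by apply/funext => u; rewrite /f psiZ.
have fK : L2norm f <= 1.
  rewrite fE (L2normZ _ _ _ (inL2_psi _ _ x)) gtr0_norm ?invr_gt0 //.
  by rewrite ler_pdivrMl // mulr1.
have supE : ((L2norm (fun v => TW (stepW (n%:R *: D)) f v - TW W f v))%:E <=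
    opnorm_diff (stepW (n%:R *: D)) W)%E.
  by apply: ereal_sup_ubound; exists f => //; split => //; exact: inL2_psi.
have := le_trans supE opE; rewrite lee_fin => fe.
rewrite -ler_pdivrMl //.
have xL : inL2 (fun v => psi (fun i => \sum_j D i j * x j) v - TW W (psi x) v).
  by apply: inL2B; [exact: inL2_psi|apply: inL2_TW; exact: inL2_psi].
rewrite -[X in X * _](gtr0_norm (_ : 0 < K^-1)) ?invr_gt0 // -L2normZ //.
rewrite (eq_L2norm _ _ (fun v => TW (stepW (n%:R *: D)) f v - TW W f v)).
  exact: fe.
move=> v Iv /=; rewrite TW_step // fE (TWZ _ _ _ (inL2_psi _ _ x)) // mulrBr -psiZ; congr (psi _ _ - _).
by apply/funext => i; rewrite mulr_sumr; apply: eq_bigr => j _; rewrite mulrCA.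
Qed.

End Graphon.

(** * Cauchy sequences of step functions *)

Section StepCauchy.
Variable R : realType.
Local Notation I := (@I01 R).

Lemma psi_eval01 (n : nat) (u : R) : (0 < n)%N -> 0 <= u < 1 ->
  exists j : 'I_n, forall x, psi x u = x j.
Proof.
move=> n0 /andP[u0 u1]; have [//|H] := psi_eval _ n u.
have nR : 0 < n%:R :> R by rewrite ltr0n.
have un0 : 0 <= u * n%:R by rewrite mulr_ge0 // ltW.
have /andP[l r] := truncn_itv un0.
have jn : (Num.truncn (u * n%:R) < n)%N.
  by rewrite -(ltr_nat R) (le_lt_trans l) // -ltr_pdivlMr // divff // gt_eqF.
(* The step function with coefficients [chiP n i u] has at [u] a sum of squares as its value,
   positive by the cell of index [truncn (u * n)]; this excludes the vanishing case of
   [psi_eval]. *)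
have : psi (fun i : 'I_n => chiP n i u) u != 0.
  rewrite gt_eqF // /psi (bigD1 (Ordinal jn)) //= ltr_pwDl //.
    by rewrite /chiP ler_pdivrMr // ltr_pdivlMr // l r /= mulr1.
  by apply: sumr_ge0 => i _; rewrite -expr2 sqr_ge0.
by rewrite H eqxx.
Qed.

Lemma psi_out (n : nat) (x : 'I_n -> R) (u : R) : 1 <= u -> psi x u = 0.
Proof.
move=> u1; apply: big1 => j _; rewrite /chiP; case: ifP => [/andP[_]|]; rewrite ?mulr0 //.
have n0 : 0 < n%:R :> R by rewrite ltr0n (leq_ltn_trans _ (ltn_ord j)).
move=> /(le_lt_trans u1); rewrite ltr_pdivlMr // mul1r ltr_nat ltnS.
by rewrite leqNgt ltn_ord.
Qed.

Lemma psiD (n : nat) (x y : 'I_n -> R) (u : R) :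
  psi (fun i => x i + y i) u = psi x u + psi y u.
Proof. by have [[j H]|H] := psi_eval _ n u; rewrite !H // addr0. Qed.

Lemma le_L2norm_psi (n : nat) (x y : 'I_n -> R) (c : R) : 0 <= c ->
  \sum_i x i ^+ 2 <= c ^+ 2 * \sum_i y i ^+ 2 ->
  L2norm (psi x) <= c * L2norm (psi y).
Proof.
move=> c0 xy; rewrite -ler_sqr ?nnegrE ?mulr_ge0 ?L2norm_ge0 //.
by rewrite exprMn !L2norm_psi mulrCA ler_wpM2l // invr_ge0.
Qed.

Definition psi_cV (n : nat) (z : 'cV[R]_n) : R -> R := psi (fun i => z i ord0).

Definition psi_cauchy (z : forall n, 'cV[R]_n) : Prop :=
  forall eps : R, 0 < eps -> exists N : nat, forall n m : nat, (N <= n)%N -> (N <= m)%N ->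
    L2norm (fun u => psi_cV n (z n) u - psi_cV m (z m) u) <= eps.

Lemma psi_cVD (n : nat) (x y : 'cV[R]_n) (u : R) :
  psi_cV n (x + y) u = psi_cV n x u + psi_cV n y u.
Proof. by rewrite -psiD; congr (psi _ _); apply/funext => i; rewrite mxE. Qed.

Lemma psi_cVB (n : nat) (x y : 'cV[R]_n) (u : R) :
  psi_cV n (x - y) u = psi_cV n x u - psi_cV n y u.
Proof. by rewrite -psiB; congr (psi _ _); apply/funext => i; rewrite !mxE. Qed.

Lemma psi_cVZ (n : nat) (c : R) (x : 'cV[R]_n) (u : R) :
  psi_cV n (c *: x) u = c * psi_cV n x u.
Proof. by rewrite -psiZ; congr (psi _ _); apply/funext => i; rewrite mxE. Qed.

Lemma inL2_psi_cV (n : nat) (x : 'cV[R]_n) : inL2 (psi_cV n x).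
Proof. exact: inL2_psi. Qed.

Lemma inL2_psi_cVB (n m : nat) (x : 'cV[R]_n) (y : 'cV[R]_m) :
  inL2 (fun u => psi_cV n x u - psi_cV m y u).
Proof. by apply: inL2B; exact: inL2_psi_cV. Qed.

Local Hint Resolve inL2_psi_cV inL2_psi_cVB : core.

Lemma psi_cauchy_bounded (z : forall n, 'cV[R]_n) : psi_cauchy z ->
  exists2 K : R, 0 < K & exists N : nat, forall n, (N <= n)%N -> L2norm (psi_cV n (z n)) <= K.
Proof.
move=> /(_ 1 ltr01)[N zN].
exists (2 * (1 + L2norm (psi_cV N (z N)))).
  by rewrite mulr_gt0 // ltr_pwDl // L2norm_ge0.
exists N => n Nn; rewrite (eq_L2norm _ _
  (fun u => (psi_cV n (z n) u - psi_cV N (z N) u) + psi_cV N (z N) u)); last first.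
  by move=> u _; rewrite subrK.
by rewrite (le_trans (L2normD _ _ _ _ _)) // ler_wpM2l // lerD2r zN.
Qed.

Lemma psi_cauchy0 : psi_cauchy (fun=> 0).
Proof.
move=> e e0; exists 0%N => n m _ _; rewrite (eq_L2norm _ _ (fun=> 0)); last first.
  move=> u _; rewrite -[X in psi_cV n X](scale0r 0) -[X in psi_cV m X](scale0r 0).
  by rewrite !psi_cVZ !mul0r subr0.
by apply: L2norm_bounded => // [|u _]; rewrite ?normr0 ltW.
Qed.

Lemma psi_cauchyD (z w : forall n, 'cV[R]_n) : psi_cauchy z -> psi_cauchy w ->
  psi_cauchy (fun n => z n + w n).
Proof.
move=> zc wc e e0; have e4 : 0 < e / 4 by rewrite divr_gt0.
have [[N zN] [M wM]] := (zc _ e4, wc _ e4).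
exists (maxn N M) => n m; rewrite !geq_max => /andP[Nn Mn] /andP[Nm Mm].
rewrite (eq_L2norm _ _ (fun u => (psi_cV n (z n) u - psi_cV m (z m) u) +
  (psi_cV n (w n) u - psi_cV m (w m) u))); last first.
  by move=> u _; rewrite !psi_cVD opprD addrACA.
rewrite (le_trans (L2normD _ _ _ _ _)) //.
by have := zN n m Nn Nm; have := wM n m Mn Mm; lra.
Qed.

Lemma psi_cauchyZ (c : R) (z : forall n, 'cV[R]_n) : psi_cauchy z ->
  psi_cauchy (fun n => c *: z n).
Proof.
move=> zc e e0; have c0 : 0 < `|c| + 1 by rewrite ltr_wpDl.
have [N zN] := zc _ (divr_gt0 e0 c0).
exists N => n m Nn Nm; rewrite (eq_L2norm _ _
  (fun u => c * (psi_cV n (z n) u - psi_cV m (z m) u))); last first.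
  by move=> u _; rewrite !psi_cVZ mulrBr.
rewrite L2normZ // (@le_trans _ _ ((`|c| + 1) * (e / (`|c| + 1)))) //.
  by rewrite ler_pM ?L2norm_ge0 ?lerDl // zN.
by rewrite mulrC divfK // gt_eqF.
Qed.

Lemma psi_cauchy_sum (J : Type) (s : seq J) (z : J -> forall n, 'cV[R]_n) :
  (forall j, psi_cauchy (z j)) -> psi_cauchy (fun n => \sum_(j <- s) z j n).
Proof.
move=> zc; elim: s => [|j s IH].
  have -> : (fun n => \sum_(j <- [::]) z j n) = (fun=> 0).
    by apply: functional_extensionality_dep => n; rewrite big_nil.
  exact: psi_cauchy0.
have -> : (fun n => \sum_(k <- j :: s) z k n) = (fun n => z j n + \sum_(k <- s) z k n).
  by apply: functional_extensionality_dep => n; rewrite big_cons.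
exact: psi_cauchyD.
Qed.

Lemma psi_cauchy_lipschitz (rho : R -> R) (z : forall n, 'cV[R]_n) :
  (exists C : R, forall a b : R, `|rho a - rho b| <= C * `|a - b|) ->
  psi_cauchy z -> psi_cauchy (fun n => \col_i rho (z n i ord0)).
Proof.
move=> [C rhoC] zc e e0; have c0 : 0 < `|C| + 1 by rewrite ltr_wpDl.
have [N zN] := zc _ (divr_gt0 e0 c0).
(* The successor makes both dimensions positive, so that the cells cover [[0, 1[]. *)
exists N.+1 => n m Nn Nm.
apply: (@le_trans _ _ ((`|C| + 1) * L2norm (fun u => psi_cV n (z n) u - psi_cV m (z m) u))).
  rewrite -[X in X * _](gtr0_norm c0) -L2normZ //; apply: le_L2norm => //.
    exact: inL2Z.
  move=> u; rewrite /I01 /= in_itv /= => /andP[u0 u1].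
  rewrite normrM (gtr0_norm c0) /psi_cV.
  (* At the endpoint [u = 1] all step functions vanish, so the inequality holds there whatever
     [rho 0] is. *)
  have [u1'|u1'] := ltP u 1; last by rewrite !psi_out // subrr normr0 mulr0.
  have u01 : 0 <= u < 1 by rewrite u0.
  have [i Hi] := psi_eval01 n u (leq_ltn_trans (leq0n _) Nn) u01.
  have [j Hj] := psi_eval01 m u (leq_ltn_trans (leq0n _) Nm) u01.
  rewrite !Hi !Hj !mxE (le_trans (rhoC _ _)) // ler_wpM2r //.
  by rewrite (le_trans (ler_norm C)) // lerDl.
by rewrite -ler_pdivlMl // mulrC; apply: zN; exact: ltnW.
Qed.

Lemma psi_cauchy_limit (z : forall n, 'cV[R]_n) (y : R -> R) : inL2 y ->
  L2norm (fun u => psi_cV n (z n) u - y u) @[n --> \oo] --> (0 : R) -> psi_cauchy z.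
Proof.
move=> yL /cvgrPdist_lt zy e e0; have e4 : 0 < e / 4 by rewrite divr_gt0.
have [N _ HN] := zy _ e4; exists N => n m Nn Nm.
have zN k : (N <= k)%N -> L2norm (fun u => psi_cV k (z k) u - y u) <= e / 4.
  by move=> Nk; have := HN k Nk; rewrite /= sub0r normrN ger0_norm ?L2norm_ge0 // => /ltW.
rewrite (le_trans (L2norm_triangle _ _ y _ _ _ _)) //.
by rewrite (L2norm_distC _ y); have := zN n Nn; have := zN m Nm; lra.
Qed.

(** A three-epsilon argument: the step functions of [z n] and [z m] are compared through those of
    [w n] and [w m]. The share [e / 10] matches the weights 2, 4 and 4 of [L2norm_triangle4]. *)
Lemma psi_cauchy_approx (z : forall n, 'cV[R]_n) :
  (forall e : R, 0 < e -> exists2 w, psi_cauchy w & exists N : nat, forall n, (N <= n)%N ->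
    L2norm (psi_cV n (z n - w n)) <= e) -> psi_cauchy z.
Proof.
move=> zw e e0; have e8 : 0 < e / 10 by rewrite divr_gt0.
have [w wc [N wN]] := zw _ e8; have [M wM] := wc _ e8.
exists (maxn N M) => n m; rewrite !geq_max => /andP[Nn Mn] /andP[Nm Mm].
have dist k : (N <= k)%N ->
    L2norm (fun u => psi_cV k (z k) u - psi_cV k (w k) u) <= e / 10.
  by move=> /wN; rewrite (eq_L2norm _ _ _ (fun u _ => psi_cVB _ _ _ u)).
rewrite (le_trans (L2norm_triangle4 _ _ (psi_cV n (w n)) (psi_cV m (w m)) _ _ _ _ _)) //.
have -> : e = 2 * (e / 10) + 4 * (e / 10) + 4 * (e / 10) by field.
apply: lerD; [apply: lerD|]; apply: ler_wpM2l => //.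
- exact: dist.
- exact: wM.
- by rewrite L2norm_distC; exact: dist.
Qed.

(** * Stability under the matrix operations of a layer *)

Section Operators.
Variables (W : R -> R -> R) (D : forall n, 'M[R]_n).
Hypothesis HW : is_graphon W.
Hypothesis DW : forall e : R, 0 < e -> exists N : nat, forall n, (N <= n)%N ->
  (opnorm_diff (stepW (n%:R *: D n)) W <= e%:E)%E.

(** The step function of [D n *m z n] is close to [T_W] applied to that of [z n], by operator norm
    convergence and boundedness of the sequence; these images are Cauchy because [T_W] is
    bounded. *)
Lemma psi_cauchy_mulmx (z : forall n, 'cV[R]_n) : psi_cauchy z ->
  psi_cauchy (fun n => D n *m z n).
Proof.
move=> zc e e0; have [mW [C WC'] _] := HW.
have WC u v : I u -> I v -> `|W u v| <= C by move=> Iu Iv; apply: WC'; rewrite inE.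
have C0 := graphon_bound_ge0 _ _ _ WC.
have [K K0 [N1 zK]] := psi_cauchy_bounded _ zc.
(* After multiplication by [K] and by [C + 1], the errors are [e / 12] and [e / 8], and
   [2 / 12 + 4 / 8 + 4 / 12 = 1]. *)
have e1 : 0 < e / (12 * K) by rewrite divr_gt0 // mulr_gt0.
have e2 : 0 < e / (8 * (C + 1)) by rewrite divr_gt0 // mulr_gt0 // ltr_wpDl.
have [[N2 DN] [N3 zN]] := (DW _ e1, zc _ e2).
pose b n := TW W (psi_cV n (z n)).
have bL n : inL2 (b n) by apply: (inL2_TW _ _ _ mW WC).
have dist k : (N1 <= k)%N -> (N2 <= k)%N -> (0 < k)%N ->
    L2norm (fun u => psi_cV k (D k *m z k) u - b k u) <= e / 12.
  move=> N1k N2k k0.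
  have := opnorm_diff_psi _ _ _ mW WC k (D k) (fun i => z k i ord0) K _ k0 K0 (zK k N1k) (DN k N2k).
  rewrite (_ : K * _ = e / 12); last by field; rewrite gt_eqF.
  apply: le_trans; rewrite le_eqVlt; apply/orP; left; apply/eqP; apply: eq_L2norm => u _.
  by congr (psi _ _ - _); apply/funext => i; rewrite mxE.
exists (maxn (maxn N1 N2) (maxn N3 1)) => n m.
rewrite !geq_max => /andP[/andP[n1 n2] /andP[n3 n0]] /andP[/andP[m1 m2] /andP[m3 m0]].
have bb : L2norm (fun u => b n u - b m u) <= e / 8.
  rewrite (eq_L2norm _ _ (TW W (fun u => psi_cV n (z n) u - psi_cV m (z m) u))).
    rewrite (le_trans (L2norm_TW _ _ _ mW WC _ _)) //.
    rewrite (@le_trans _ _ ((C + 1) * (e / (8 * (C + 1))))) //.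
      by rewrite ler_pM ?L2norm_ge0 ?lerDl // zN.
    rewrite le_eqVlt; apply/orP; left; apply/eqP; field.
    by rewrite gt_eqF // ltr_wpDl.
  by move=> u Iu; rewrite (TWB _ _ _ mW WC).
rewrite (le_trans (L2norm_triangle4 _ _ (b n) (b m) _ _ _ _ _)) //.
have -> : e = 2 * (e / 12) + 4 * (e / 8) + 4 * (e / 12) by field.
apply: lerD; [apply: lerD|]; apply: ler_wpM2l => //.
- exact: dist.
- by rewrite L2norm_distC; exact: dist.
Qed.

Lemma psi_cauchy_poly (p : {poly R}) (z : forall n, 'cV[R]_n) : psi_cauchy z ->
  psi_cauchy (fun n => poly_mx p (D n) *m z n).
Proof.
move=> zc.
have -> : (fun n => poly_mx p (D n) *m z n) =
    (fun n => \sum_(i <- index_enum 'I_(size p)) p`_i *: (iter i (mulmx (D n)) 1%:M *m z n)).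
  apply: functional_extensionality_dep => n; rewrite /poly_mx mulmx_suml.
  by apply: eq_bigr => i _; rewrite scalemxAl.
apply: (psi_cauchy_sum _ _ (fun (i : 'I_(size p)) n => p`_i *: (iter i (mulmx (D n)) 1%:M *m z n))).
move=> i; apply: psi_cauchyZ; elim: (val i) => [|k IH] /=.
  have -> // : (fun n => 1%:M *m z n) = z.
  by apply: functional_extensionality_dep => n; rewrite mul1mx.
have -> : (fun n => D n *m iter k (mulmx (D n)) 1%:M *m z n) =
    (fun n => D n *m (iter k (mulmx (D n)) 1%:M *m z n)).
  by apply: functional_extensionality_dep => n; rewrite mulmxA.
exact: psi_cauchy_mulmx.
Qed.

(** One polynomial [p] approximates [h] on [[-C, C]] for all [n] at once, whereas the interpolant
    [q] behind [matfun] varies with [n]. On the spectrum [q - p] equals [h - p], so the spectral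
    bound controls [(q - p)(D n)] uniformly. *)
Lemma psi_cauchy_matfun (h : R -> R) (C : R) (z : forall n, 'cV[R]_n) :
  continuous h -> (forall n, (D n)^T = D n) ->
  (forall n (i j : 'I_n), `|(n%:R *: D n) i j| <= C) ->
  psi_cauchy z -> psi_cauchy (fun n => matfun h (D n) *m z n).
Proof.
move=> hc Dsym DC zc; apply: psi_cauchy_approx => e e0.
have [K K0 [N zK]] := psi_cauchy_bounded _ zc.
have eK : 0 < e / K by rewrite divr_gt0.
have [p pP] := weierstrass_approximation _ h C _ hc eK.
exists (fun n => poly_mx p (D n) *m z n); first exact: psi_cauchy_poly.
(* Dimension [0] is excluded because [horner_mx] takes matrices of size [n.+1]. *)
exists N.+1 => -[//|n] Nn.
have [q qP ->] := matfunP _ _ h (D n.+1).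
rewrite -mulmxBl !poly_mx_horner -rmorphB.
rewrite (@le_trans _ _ (e / K * L2norm (psi_cV n.+1 (z n.+1)))) //; last first.
  by rewrite -ler_pdivlMl // invf_div divfK ?gt_eqF // zK // ltnW.
apply: le_L2norm_psi; first exact: ltW.
apply: horner_mx_sumsq_le => // a Da; rewrite hornerD hornerN qP // distrC.
by apply: pP; exact: is_eigval_bound (DC n.+1) Da.
Qed.

End Operators.
End StepCauchy.

(** * Propagation of the Cauchy property through the layers *)

Theorem theorem5p15 (R : realType) (L : nat) (F : nat -> nat)
  (h : nat -> nat -> nat -> R -> R) (M : nat -> nat -> nat -> R) (rho : R -> R)
  (Delta : forall n : nat, 'M[R]_n) (W : R -> R -> R)
  (pi : forall n : nat, 'S_n)
  (x : forall n : nat, 'M[R]_(n, F 0%N)) (y : 'I_(F 0%N) -> R -> R)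
  (Hh : forall l j k : nat, (1 <= l <= L)%N -> (j < F l)%N -> (k < F l.-1)%N ->
          continuous (h l j k))
  (Hrho : exists C : R, forall a b : R, `|rho a - rho b| <= C * `|a - b|)
  (Hsym : forall n : nat, (Delta n)^T = Delta n)
  (HW : is_graphon W)
  (Hbd : exists C : R, forall (n : nat) (i j : 'I_n), `|(n%:R *: Delta n) i j| <= C)
  (Hhom : forall (k : nat) (E : {set 'I_k * 'I_k}), simple_edges E ->
     hom_graph E (n%:R *: Delta n) @[n --> \oo] --> hom_graphon E W)
  (Hop : opnorm_diff (stepW (perm_mat (pi n) (n%:R *: Delta n))) W @[n --> \oo]
           --> (0 : \bar R))
  (Hy : forall k : 'I_(F 0%N), inL2 (y k))
  (Hxy : forall k : 'I_(F 0%N),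
     L2norm (fun u => psi (fun i => perm_feat (pi n) (x n) i k) u - y k u)
       @[n --> \oo] --> (0 : R)) :
  let out := fun n : nat =>
    @scnn_real R F h M rho n (perm_mat (pi n) (Delta n)) (perm_feat (pi n) (x n)) L in
  forall eps : R, 0 < eps -> exists N : nat, forall n m : nat, (N <= n)%N -> (N <= m)%N ->
    \big[Num.max/0]_(k < F L)
      L2norm (fun u => psi (fun i => out n i k) u - psi (fun i => out m i k) u) <= eps.
Proof.
pose D n := perm_mat (pi n) (Delta n).
have Dsym n : (D n)^T = D n.
  by apply/matrixP => i j; rewrite !mxE -[in LHS]Hsym mxE.
have [C DeltaC] := Hbd.
have DC n (i j : 'I_n) : `|(n%:R *: D n) i j| <= C.
  by have := DeltaC n (pi n i) (pi n j); rewrite !mxE.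
have DW e : 0 < e -> exists N : nat, forall n, (N <= n)%N ->
    (opnorm_diff (stepW (n%:R *: D n)) W <= e%:E)%E.
  move=> e0.
  have /Hop[N _ HN] : nbhs (0 : \bar R) [set u | u < e%:E]%E.
    by apply: open_ereal_lt'; rewrite lte_fin.
  exists N => n Nn; rewrite (_ : n%:R *: D n = perm_mat (pi n) (n%:R *: Delta n)).
    exact: ltW (HN n Nn).
  by apply/matrixP => i j; rewrite !mxE.
move=> out; pose X n l := @scnn_real R F h M rho n (D n) (perm_feat (pi n) (x n)) l.
(* Induction on the layer, one feature column at a time: the input columns converge in [L^2], and a
   layer applies [matfun], a weighted sum and the Lipschitz map [rho]. *)
have Xc l : (l <= L)%N -> forall k : 'I_(F l), psi_cauchy R (fun n => col k (X n l)).
  elim: l => [_ k|l IH lL k].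
    apply: psi_cauchy_limit (Hy k) _.
    rewrite (_ : (fun n => _) = (fun n => L2norm (fun u =>
      psi (fun i => perm_feat (pi n) (x n) i k) u - y k u))); first exact: Hxy.
    apply/funext => n; apply: eq_L2norm => u _; congr (psi _ u - _).
    by apply/funext => i; rewrite mxE.
  pose z n := \sum_(j <- index_enum 'I_(F l))
    M l.+1 k j *: (matfun (h l.+1 k j) (D n) *m col j (X n l)).
  have -> : (fun n => col k (X n l.+1)) = (fun n => \col_i rho (z n i ord0)).
    by apply: functional_extensionality_dep => n; apply/matrixP => i j; rewrite !mxE.
  apply: psi_cauchy_lipschitz => //.
  apply: (psi_cauchy_sum _ _ _ (fun (j : 'I_(F l)) n =>
    M l.+1 k j *: (matfun (h l.+1 k j) (D n) *m col j (X n l)))) => j.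
  apply: psi_cauchyZ; apply: (psi_cauchy_matfun _ _ _ HW DW _ C _ _ Dsym DC (IH (ltnW lL) j)).
  exact: Hh.
move=> eps eps0.
(* Each output feature has its own threshold; the largest of these finitely many serves the maximum
   norm. *)
have /choice[N HN] k : exists N : nat, forall n m : nat, (N <= n)%N -> (N <= m)%N ->
    L2norm (fun u => psi (fun i => out n i k) u - psi (fun i => out m i k) u) <= eps.
  have colE n : psi_cV R n (col k (X n L)) = psi (fun i => out n i k).
    by congr psi; apply/funext => i; rewrite mxE.
  have [N HN] := Xc L (leqnn L) k eps eps0; exists N => n m Nn Nm.
  by have := HN n m Nn Nm; rewrite !colE.
exists (\max_k N k)%N => n m Nn Nm.
apply: bigmax_le => [|k _]; first exact: ltW.
by apply: HN; [exact: leq_trans (leq_bigmax k) Nn|exact: leq_trans (leq_bigmax k) Nm].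
Qed.
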